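(* Let $x_1,\ldots,x_n\in\mathbb{R}^d$ with $n\ge d+1$, and let $w_i>0$ with $\sum_{i=1}^n w_i=1$. Let $(\nu_r,\mu_r,\Sigma_r)_{r\in\mathbb{N}_0}$ be a sequence in $\mathbb{R}_{>0}\times\mathbb{R}^d\times\mathrm{SPD}(d)$ generated by one of the three algorithms aEM, MMF or GMMF described in the context, starting from arbitrary initial values $\nu_0>0$, $\mu_0\in\mathbb{R}^d$, $\Sigma_0\in\mathrm{SPD}(d)$. For the GMMF algorithm assume that in each step $r$ the inner loop converges (to a limit in $\mathbb{R}_{>0}$). Then for all $r\in\mathbb{N}_0$, $$L(\nu_r,\mu_r,\Sigma_r)\ge L(\nu_{r+1},\mu_{r+1},\Sigma_{r+1}),$$ with equality if and only if $(\nu_r,\mu_r,\Sigma_r)=(\nu_{r+1},\mu_{r+1},\Sigma_{r+1})$.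
   Context: $\mathrm{SPD}(d)$ is the set of symmetric positive definite real $d\times d$ matrices. The objective function (negative log-likelihood of the multivariate Student-$t$ distribution up to constants) is $$L(\nu,\mu,\Sigma)=-2\log\Gamma\left(\tfrac{d+\nu}{2}\right)+2\log\Gamma\left(\tfrac{\nu}{2}\right)-\nu\log(\nu)+(d+\nu)\sum_{i=1}^n w_i\log\left(\nu+(x_i-\mu)^{T}\Sigma^{-1}(x_i-\mu)\right)+\log|\Sigma|.$$ Let $\psi=\Gamma'/\Gamma$ be the digamma function and $\phi(x)=\psi(x)-\log(x)$, $x>0$. All three algorithms share the following step. Given $(\nu_r,\mu_r,\Sigma_r)$ put $\delta_{i,r}=(x_i-\mu_r)^{T}\Sigma_r^{-1}(x_i-\mu_r)$, $\gamma_{i,r}=\frac{\nu_r+d}{\nu_r+\delta_{i,r}}$, and $$\mu_{r+1}=\frac{\sum_{i=1}^n w_i\gamma_{i,r}x_i}{\sum_{i=1}^n w_i\gamma_{i,r}},\qquad \Sigma_{r+1}=\frac{\sum_{i=1}^n w_i\gamma_{i,r}(x_i-\mu_{r+1})(x_i-\mu_{r+1})^{T}}{\sum_{i=1}^n w_i\gamma_{i,r}},\qquad \delta_{i,r+1}=(x_i-\mu_{r+1})^{T}\Sigma_{r+1}^{-1}(x_i-\mu_{r+1}).$$ For $\nu>0$ set $F_b(\nu)=\sum_{i=1}^n w_i\left(\frac{\nu+d}{\nu+\delta_{i,r+1}}-\log\left(\frac{\nu+d}{\nu+\delta_{i,r+1}}\right)-1\right)$. The algorithms differ in the update of $\nu$: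 - aEM: $\nu_{r+1}$ is the zero of $\nu\mapsto\phi(\frac{\nu}{2})-\phi(\frac{\nu_r+d}{2})+F_b(\nu_r)$. - MMF: $\nu_{r+1}$ is the zero of $\nu\mapsto\phi(\frac{\nu}{2})-\phi(\frac{\nu+d}{2})+F_b(\nu_r)$. - GMMF: an inner loop is run with $\nu_{r,0}=\nu_r$ and, for $l=0,1,\ldots$, $\nu_{r,l+1}$ the zero of $\nu\mapsto\phi(\frac{\nu}{2})-\phi(\frac{\nu+d}{2})+F_b(\nu_{r,l})$; then $\nu_{r+1}=\lim_{l\to\infty}\nu_{r,l}$. A sequence ''generated by'' an algorithm is a sequence in $\mathbb{R}_{>0}\times\mathbb{R}^d\times\mathrm{SPD}(d)$ satisfying these recursions for all $r$ (so all required zeros exist and all $\Sigma_r$ are positive definite). *)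

(* Defs.v *)
From HB Require Import structures.
From mathcomp Require Export all_boot all_order all_algebra.
From mathcomp Require Export all_classical all_reals all_analysis.

Set Implicit Arguments.
Unset Strict Implicit.
Unset Printing Implicit Defensive.

Export Order.TTheory GRing.Theory Num.Theory.
Export numFieldNormedType.Exports.

Open Scope classical_set_scope.
Open Scope ring_scope.

Section SpecialFunctions.
Context {R : realType}.

(* Euler's integral; it is the Gamma function only for 0 < z, where it is
   used. For z <= 0 the integral diverges and [Gamma z] is 0. *)
Definition Gamma (z : R) : R :=
  \int[lebesgue_measure]_(t in `]0, +oo[) (t `^ (z - 1) * expR (- t)).

Definition digamma (z : R) : R := derive1 Gamma z / Gamma z.

Definition phi (z : R) : R := digamma z - ln z.

End SpecialFunctions.

Definition SPD {R : realType} {d : nat} (S : 'M[R]_d) : Prop :=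
  S \is symmetricmx /\ forall v : 'cV[R]_d, v != 0 -> 0 < (v^T *m S *m v) 0 0.

Section Student.
Context {R : realType} {d n : nat}.
Variables (x : 'I_n -> 'cV[R]_d) (w : 'I_n -> R).

Definition delta (mu : 'cV[R]_d) (S : 'M[R]_d) (i : 'I_n) : R :=
  ((x i - mu)^T *m invmx S *m (x i - mu)) 0 0.

Definition negloglik (nu : R) (mu : 'cV[R]_d) (S : 'M[R]_d) : R :=
  - 2 * ln (Gamma ((d%:R + nu) / 2)) + 2 * ln (Gamma (nu / 2)) - nu * ln nu
  + (d%:R + nu) * (\sum_(i < n) w i * ln (nu + delta mu S i))
  + ln (\det S).

Definition gamma (nu : R) (mu : 'cV[R]_d) (S : 'M[R]_d) (i : 'I_n) : R :=
  (nu + d%:R) / (nu + delta mu S i).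

Definition next_mu (nu : R) (mu : 'cV[R]_d) (S : 'M[R]_d) : 'cV[R]_d :=
  (\sum_(i < n) w i * gamma nu mu S i)^-1 *:
    \sum_(i < n) (w i * gamma nu mu S i) *: x i.

Definition next_Sigma (nu : R) (mu : 'cV[R]_d) (S : 'M[R]_d) : 'M[R]_d :=
  let mu' := next_mu nu mu S in
  (\sum_(i < n) w i * gamma nu mu S i)^-1 *:
    \sum_(i < n) (w i * gamma nu mu S i) *: ((x i - mu') *m (x i - mu')^T).

(* [mu] and [S] are the already updated parameters of the current step. *)
Definition F_b (mu : 'cV[R]_d) (S : 'M[R]_d) (nu : R) : R :=
  \sum_(i < n) w i * (gamma nu mu S i - ln (gamma nu mu S i) - 1).

Definition positive_zero (f : R -> R) (nu : R) : Prop := 0 < nu /\ f nu = 0.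

Definition aEM_update (mu : 'cV[R]_d) (S : 'M[R]_d) (nu nu' : R) : Prop :=
  positive_zero
    (fun t => phi (t / 2) - phi ((nu + d%:R) / 2) + F_b mu S nu) nu'.

Definition MMF_update (mu : 'cV[R]_d) (S : 'M[R]_d) (nu nu' : R) : Prop :=
  positive_zero
    (fun t => phi (t / 2) - phi ((t + d%:R) / 2) + F_b mu S nu) nu'.

Definition GMMF_update (mu : 'cV[R]_d) (S : 'M[R]_d) (nu nu' : R) : Prop :=
  exists inner : nat -> R,
    [/\ inner 0%N = nu,
        forall l, MMF_update mu S (inner l) (inner l.+1),
        inner @ \oo --> nu'
      & 0 < nu'].

Inductive algorithm := aEM | MMF | GMMF.

Definition nu_update (alg : algorithm) :
    'cV[R]_d -> 'M[R]_d -> R -> R -> Prop :=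
  match alg with
  | aEM => aEM_update
  | MMF => MMF_update
  | GMMF => GMMF_update
  end.

Definition generated_by (alg : algorithm)
    (nu : nat -> R) (mu : nat -> 'cV[R]_d) (Sigma : nat -> 'M[R]_d) : Prop :=
  (forall r, 0 < nu r /\ SPD (Sigma r)) /\
  forall r,
    [/\ mu r.+1 = next_mu (nu r) (mu r) (Sigma r),
        Sigma r.+1 = next_Sigma (nu r) (mu r) (Sigma r)
      & nu_update alg (mu r.+1) (Sigma r.+1) (nu r) (nu r.+1)].

End Student.

(* Main.v *)
(* For fixed nu, concavity of ln and the inequality
   ln det B - ln det A <= tr (A^-1 B) - d between positive definite matrices
   give the descent in (mu, Sigma). For fixed (mu, Sigma) the derivative of L is
   phi (nu / 2) - phi ((nu + d) / 2) + F_b nu. Here F_b is nonincreasing, and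
   phi and phi (nu / 2) - phi ((nu + d) / 2) are strictly increasing, so each
   update equation forces this derivative to have a constant sign between nu_r
   and nu_{r+1}, the one that makes L decrease. The two monotonicity facts on
   phi come from phi (z + 1) - phi z = 1 / z - ln (1 + 1 / z), a decreasing and
   strictly convex function of z, and from - 1 / z <= phi z <= 0, which is
   Jensen's inequality for the Gamma density. *)
Require Import Defs.
From mathcomp Require Import measurable_realfun ring lra.

Set Implicit Arguments.
Unset Strict Implicit.
Unset Printing Implicit Defensive.

(** * Symmetric positive definite matrices *)

Lemma dot_colE {R : realType} {n : nat} (u v : 'cV[R]_n) :
  (u^T *m v) 0 0 = \sum_i u i 0 * v i 0.
Proof. by rewrite mxE; apply: eq_bigr => i _; rewrite mxE. Qed.

Lemma SPD_tr {R : realType} {n : nat} (S : 'M[R]_n) : SPD S -> S^T = S.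
Proof.
case=> /is_hermitianmxP + _; rewrite expr0 scale1r.
by rewrite map_mx_id // => ->; rewrite trmxK.
Qed.

Lemma SPD_intro {R : realType} {n : nat} (S : 'M[R]_n) : S^T = S ->
  (forall v : 'cV[R]_n, v != 0 -> 0 < (v^T *m S *m v) 0 0) -> SPD S.
Proof.
move=> sS pS; split=> //; apply/is_hermitianmxP.
by rewrite expr0 scale1r map_mx_id.
Qed.

(** Completing the square: for fixed [v] the quadratic form of the block matrix is smallest when the
    first coordinate is [- a^-1 *: (u *m v)], and its value there is the form of the Schur
    complement at [v]. *)
Lemma SPD_schur {R : realType} {n : nat} (a : R) (u : 'rV[R]_n) (N : 'M[R]_n) :
  SPD (block_mx a%:M u u^T N) -> 0 < a /\ SPD (N - a^-1 *: (u^T *m u)).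
Proof.
move=> SP; have := SPD_tr SP; rewrite tr_block_mx => /eq_block_mx[_ _ _ NT].
have {SP} pS := SP.2.
have a0 : 0 < a.
  have := pS (col_mx 1%:M 0); rewrite tr_col_mx mul_row_block mul_row_col.
  rewrite !trmx0 !mul0mx !mulmx0 !addr0 trmx1 mul1mx mulmx1 mxE eqxx mulr1n.
  apply; apply/eqP => /(congr1 (fun M => usubmx M 0 0)).
  by rewrite col_mxKu !mxE /= => /eqP; rewrite oner_eq0.
split=> //; apply: SPD_intro.
  by rewrite linearB /= linearZ /= trmx_mul trmxK NT.
move=> v v0; pose z := col_mx (- a^-1 *: (u *m v)) v.
have : z != 0.
  apply: contra_neq v0 => z0; have := congr1 dsubmx z0.
  by rewrite col_mxKd linear0.
move=> /pS; rewrite /z tr_col_mx mul_row_block mul_row_col.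
have -> : (- a^-1 *: (u *m v))^T = - a^-1 *: (v^T *m u^T).
  by rewrite linearZ /= trmx_mul.
rewrite mul_mx_scalar scalerA.
rewrite mulrN mulfV ?gt_eqF // scaleN1r addNr mul0mx add0r mulmxDl mulmxBr mulmxBl.
by rewrite -!scalemxAr -!scalemxAl !mulmxA scaleNr addrC.
Qed.

(** Induction on the dimension: a first column made of [Num.sqrt a] and of [u^T] divided by it
    leaves the Schur complement to be factored. A triangular factor turns determinants into products
    of diagonal entries. *)
Lemma cholesky {R : realType} {n : nat} (S : 'M[R]_n) : SPD S ->
  exists2 Q : 'M[R]_n, S = Q *m Q^T & is_trig_mx Q /\ forall i, 0 < Q i i.
Proof.
elim: n S => [S _|n IHn].
  exists 1; first by rewrite [LHS]flatmx0 [RHS]flatmx0.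
  by split; [apply/is_trig_mxP => -[] | case].
change n.+1 with (1 + n)%N => S SP.
have ulE : ulsubmx S = (S 0 0)%:M.
  rewrite [LHS]mx11_scalar; congr (_%:M).
  by rewrite !mxE; congr (S _ _); exact/val_inj.
have dlE : dlsubmx S = (ursubmx S)^T.
  by rewrite -{1}(SPD_tr SP) trmx_ursub.
have SE := esym (submxK S); rewrite ulE dlE in SE.
rewrite SE in SP; have [a0 /IHn[Q TE [Qtrig Qpos]]] := SPD_schur SP.
set a := S 0 0 in SE a0 TE; set u := ursubmx _ in SE TE; set N := drsubmx _ in SE TE.
have s0 : 0 < Num.sqrt a by rewrite sqrtr_gt0.
have ss : Num.sqrt a * Num.sqrt a = a by rewrite -expr2 sqr_sqrtr // ltW.
exists (block_mx (Num.sqrt a)%:M 0 ((Num.sqrt a)^-1 *: u^T) Q).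
  rewrite SE tr_block_mx mulmx_block !trmx0 !mulmx0 !mul0mx !addr0.
  rewrite tr_scalar_mx -scalar_mxM ss; congr block_mx.
  - by rewrite linearZ /= trmxK mul_scalar_mx scalerA mulfV ?scale1r ?gt_eqF.
  - by rewrite mul_mx_scalar scalerA mulfV ?scale1r ?gt_eqF.
  - rewrite -TE linearZ /= trmxK -scalemxAl -scalemxAr scalerA -invfM ss.
    by rewrite addrC subrK.
split; first by rewrite is_trig_block_mx // eqxx Qtrig mx11_is_trig.
move=> i; rewrite -(splitK i).
case: (fintype.split i) => j /=; last by rewrite block_mxEdr.
by rewrite block_mxEul ord1 mxE eqxx mulr1n.
Qed.

Lemma ln_ltB1 {R : realType} (x : R) : 0 < x -> x != 1 -> ln x < x - 1.
Proof.
move=> x0 x1; have := @expR_gt1Dx _ (ln x); rewrite lnK ?posrE // => H.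
by rewrite ltrBrDl H // ln_eq0.
Qed.

Lemma ln_leB1 {R : realType} (x : R) : 0 < x -> ln x <= x - 1.
Proof.
have [->|x1 x0] := eqVneq x 1; first by rewrite ln1 subrr.
exact/ltW/ln_ltB1.
Qed.

Lemma ln_eqB1 {R : realType} (x : R) : 0 < x -> ln x = x - 1 -> x = 1.
Proof.
by move=> x0 e; apply/eqP/contraT => /(ln_ltB1 x0); rewrite e ltxx.
Qed.

Lemma ln_prod {R : realType} (I : finType) (f : I -> R) : (forall i, 0 < f i) ->
  0 < \prod_i f i /\ ln (\prod_i f i) = \sum_i ln (f i).
Proof.
move=> f0; apply: (big_ind2 (fun p s => 0 < p /\ ln p = s)); first by rewrite ltr01 ln1.
  by move=> p s q t [p0 <-] [q0 <-]; rewrite mulr_gt0 // lnM.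
by move=> i _.
Qed.

Lemma SPD_unit {R : realType} {n : nat} (S : 'M[R]_n) : SPD S ->
  exists2 P : 'M[R]_n, P \in unitmx & S = P *m P^T.
Proof.
move=> /cholesky[Q SE [Qt Q0]]; exists Q => //.
by rewrite unitmxE det_trig // unitfE gt_eqF // prodr_gt0.
Qed.

Lemma SPD_det_gt0 {R : realType} {n : nat} (S : 'M[R]_n) : SPD S -> 0 < \det S.
Proof.
move=> /SPD_unit[P Pu ->]; rewrite det_mulmx det_tr.
by rewrite lt_neqAle eq_sym mulf_neq0 -?unitfE -?unitmxE // -expr2 sqr_ge0.
Qed.

Lemma SPD_unitmx {R : realType} {n : nat} (S : 'M[R]_n) : SPD S -> S \in unitmx.
Proof. by move=> /SPD_det_gt0 S0; rewrite unitmxE unitfE gt_eqF. Qed.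

(** With [S = Q *m Q^T], the trace is the sum of the squared entries of [Q], and [\det S] is the
    product of the [Q i i ^+ 2]. The gap is then a sum of nonnegative terms, all zero only when [Q]
    is the identity. *)
Lemma SPD_ln_det_le {R : realType} {n : nat} (S : 'M[R]_n) : SPD S ->
  ln (\det S) <= \tr S - n%:R /\
  (ln (\det S) = \tr S - n%:R -> S = 1%:M).
Proof.
move=> /cholesky[Q SE [Qt Q0]].
have [_ detE] := ln_prod Q0.
pose e i := (Q i i ^+ 2 - 1 - ln (Q i i ^+ 2)) + \sum_(j | j != i) Q i j ^+ 2.
have diag0 i : 0 <= Q i i ^+ 2 - 1 - ln (Q i i ^+ 2).
  by rewrite subr_ge0 ln_leB1 // exprn_gt0.
have off0 i : 0 <= \sum_(j | j != i) Q i j ^+ 2.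
  by apply: sumr_ge0 => j _; exact: sqr_ge0.
have e0 i : 0 <= e i by rewrite addr_ge0.
have gapE : \tr S - n%:R - ln (\det S) = \sum_i e i.
  have -> : ln (\det S) = \sum_i ln (Q i i ^+ 2).
    have P0 : 0 < \det Q by rewrite det_trig // prodr_gt0.
    rewrite SE det_mulmx det_tr lnM ?posrE //.
    rewrite det_trig // detE -big_split; apply: eq_bigr => i _ /=.
    by rewrite lnXn // mulr2n.
  have -> : n%:R = \sum_(i < n) (1 : R) by rewrite sumr_const card_ord.
  rewrite /mxtrace -!sumrB; apply: eq_bigr => i _.
  rewrite SE mxE (bigD1 i) //= mxE -expr2.
  rewrite (eq_bigr (fun j => Q i j ^+ 2)); last by move=> j _; rewrite mxE expr2.
  by rewrite /e; ring.
split=> [|eqS]; first by rewrite -subr_ge0 gapE sumr_ge0.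
have /eqP : \sum_i e i = 0 by rewrite -gapE eqS subrr.
rewrite psumr_eq0 // => /allP ei0.
have {}ei0 i : e i = 0 by apply/eqP/ei0; rewrite mem_index_enum.
suff Q1 : Q = 1%:M by rewrite SE Q1 trmx1 mulmx1.
apply/matrixP => i j; rewrite !mxE.
have /eqP := ei0 i; rewrite paddr_eq0 // => /andP[/eqP di /eqP oi].
have [<-|ij] := eqVneq i j.
  have q1 : Q i i ^+ 2 = 1.
    by apply: ln_eqB1; [rewrite exprn_gt0 | apply/eqP; rewrite eq_sym -subr_eq0 di].
  by apply/eqP; rewrite -sqrp_eq1 ?q1 // ltW.
move/eqP: oi; rewrite psumr_eq0 => [/allP|k _]; last exact: sqr_ge0.
move=> /(_ j); rewrite mem_index_enum eq_sym ij => /(_ isT) /=.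
by rewrite sqrf_eq0 => /eqP.
Qed.

(** The form is the squared Euclidean norm of [invmx P *m v], where [S = P *m P^T]. *)
Lemma SPD_inv_form_ge0 {R : realType} {n : nat} (S : 'M[R]_n) (v : 'cV[R]_n) :
  SPD S -> 0 <= (v^T *m invmx S *m v) 0 0 /\
  ((v^T *m invmx S *m v) 0 0 = 0 -> v = 0).
Proof.
move=> /SPD_unit[P Pu ->].
have PTu : P^T \in unitmx by rewrite unitmx_tr.
have -> : v^T *m invmx (P *m P^T) *m v = (invmx P *m v)^T *m (invmx P *m v).
  have PP : P *m P^T \in unitmx by rewrite unitmx_mul Pu.
  have -> : invmx (P *m P^T) = (invmx P)^T *m invmx P.
    apply: (can_inj (mulKmx PP)).
    by rewrite mulmxV // trmx_inv !mulmxA mulmxK // mulmxV.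
  by rewrite trmx_mul !mulmxA.
rewrite dot_colE; set y := invmx P *m v; split.
  by apply: sumr_ge0 => i _; rewrite -expr2 sqr_ge0.
move=> /eqP; rewrite psumr_eq0 => [/allP y0|i _]; last by rewrite -expr2 sqr_ge0.
suff: y = 0 by move=> /(congr1 (mulmx P)); rewrite mulmx0 mulKVmx.
apply/matrixP => i j; rewrite (ord1 j); have := y0 i; rewrite mem_index_enum => /(_ isT) /=.
by rewrite mulf_eq0 orbb => /eqP ->; rewrite mxE.
Qed.

Lemma SPD_congr {R : realType} {n : nat} (P S : 'M[R]_n) :
  P \in unitmx -> SPD S -> SPD (P *m S *m P^T).
Proof.
move=> Pu SP; apply: SPD_intro; first by rewrite !trmx_mul trmxK (SPD_tr SP) mulmxA.
move=> v v0; have := SP.2 (P^T *m v); rewrite trmx_mul trmxK !mulmxA; apply.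
by apply: contra_neq v0 => /(congr1 (mulmx (invmx P)^T)); rewrite trmx_inv mulmx0 mulKmx ?unitmx_tr.
Qed.

(** A congruence taking [A] to the identity takes [B] to a matrix [M] with the trace of
    [invmx A *m B] and determinant [\det B / \det A], so [SPD_ln_det_le] applies to [M]. *)
Lemma ln_det_sub_le {R : realType} {n : nat} (A B : 'M[R]_n) :
  SPD A -> SPD B ->
  ln (\det B) - ln (\det A) <= \tr (invmx A *m B) - n%:R /\
  (ln (\det B) - ln (\det A) = \tr (invmx A *m B) - n%:R -> B = A).
Proof.
move=> AP BP; have [P Pu AE] := SPD_unit AP.
have PTu : P^T \in unitmx by rewrite unitmx_tr.
have iPu : invmx P \in unitmx by rewrite unitmx_inv.
have MP := SPD_congr iPu BP.
set M := invmx P *m B *m (invmx P)^T in MP.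
have BE : B = P *m M *m P^T.
  by rewrite /M trmx_inv !mulmxA mulmxV // mul1mx mulmxKV.
clearbody M.
have -> : \tr (invmx A *m B) = \tr M.
  have -> : invmx A *m B = invmx P^T *m (M *m P^T).
    apply: (can_inj (mulKmx (SPD_unitmx AP))); rewrite mulKVmx ?SPD_unitmx //.
    by rewrite AE BE !mulmxA mulmxK.
  by rewrite mxtrace_mulC mulmxK.
have -> : ln (\det B) - ln (\det A) = ln (\det M).
  rewrite -ln_div ?posrE ?SPD_det_gt0 // AE BE !det_mulmx !det_tr.
  by congr ln; have := Pu; rewrite unitmxE unitfE => d0; field.
have [le_ eq_] := SPD_ln_det_le MP; split=> // /eq_ M1.
by rewrite BE AE M1 mulmx1.
Qed.

(** * Descent in location and scatter *)

Section LocationScatter.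
Context {R : realType} {d n : nat}.
Variables (x : 'I_n -> 'cV[R]_d) (w : 'I_n -> R).

(** Linearity in the outer product turns weighted sums of distances into traces against scatter
    matrices. *)
Lemma delta_trace (mu : 'cV[R]_d) (S : 'M[R]_d) (i : 'I_n) :
  delta x mu S i = \tr (invmx S *m ((x i - mu) *m (x i - mu)^T)).
Proof.
rewrite /delta mulmxA mxtrace_mulC mulmxA.
by rewrite /mxtrace big_ord1.
Qed.

Lemma delta_ge0 (mu : 'cV[R]_d) (S : 'M[R]_d) (i : 'I_n) :
  SPD S -> 0 <= delta x mu S i.
Proof. by move=> SP; have [] := SPD_inv_form_ge0 (x i - mu) SP. Qed.

Lemma gamma_gt0 (nu : R) (mu : 'cV[R]_d) (S : 'M[R]_d) (i : 'I_n) :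
  0 < nu -> SPD S -> 0 < gamma x nu mu S i.
Proof.
by move=> nu0 SP; rewrite divr_gt0 // ltr_wpDr // delta_ge0.
Qed.

Lemma sum_weighted_delta (g : 'I_n -> R) (mu : 'cV[R]_d) (S : 'M[R]_d) :
  \sum_i g i * delta x mu S i =
  \tr (invmx S *m (\sum_i g i *: ((x i - mu) *m (x i - mu)^T))).
Proof.
rewrite mulmx_sumr raddf_sum; apply: eq_bigr => i _ /=.
by rewrite delta_trace -scalemxAr mxtraceZ.
Qed.

(** The parallel axis identity: the cross terms vanish because the deviations from [mu'] have
    weighted sum zero. *)
Lemma scatter_shift (g : 'I_n -> R) (mu mu' : 'cV[R]_d) :
  \sum_i g i *: (x i - mu') = 0 ->
  \sum_i g i *: ((x i - mu) *m (x i - mu)^T) =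
  \sum_i g i *: ((x i - mu') *m (x i - mu')^T)
  + (\sum_i g i) *: ((mu' - mu) *m (mu' - mu)^T).
Proof.
move=> c0; set v := mu' - mu.
transitivity (\sum_i g i *: ((x i - mu') *m (x i - mu')^T)
   + (\sum_i g i *: (x i - mu')) *m v^T + v *m (\sum_i g i *: (x i - mu'))^T
   + (\sum_i g i) *: (v *m v^T)).
  rewrite raddf_sum /= mulmx_suml mulmx_sumr scaler_suml -!big_split /=.
  apply: eq_bigr => i _; rewrite linearZ /= -scalemxAl -scalemxAr -!scalerDr.
  rewrite (_ : x i - mu = (x i - mu') + v); last by rewrite /v addrA subrK.
  have -> : (x i - mu' + v)^T = (x i - mu')^T + v^T by rewrite linearD.
  congr (_ *: _); move: (x i - mu') (v) => y u.
  by rewrite mulmxDr !mulmxDl addrACA addrA.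
by rewrite c0 trmx0 mul0mx mulmx0 !addr0.
Qed.

Hypothesis w_gt0 : forall i, 0 < w i.
Hypothesis w_sum1 : \sum_i w i = 1.

(* With [a] the sum of the weights, Jensen gives
   [sum w_i ln ((nu + delta'_i) / (nu + delta_i)) <= ln a] and [ln_det_sub_le]
   is applied to [a *: S'] rather than [S']: the scaling compensates for the
   normalisation by [a] in [next_Sigma], and the sum of the two bounds is at
   most [nu * (ln a + 1 - a) <= 0]. *)
Lemma location_scatter_descent (nu : R) (mu : 'cV[R]_d) (S : 'M[R]_d) :
  let mu' := next_mu x w nu mu S in
  let S' := next_Sigma x w nu mu S in
  0 < nu -> SPD S -> SPD S' ->
  negloglik x w nu mu' S' <= negloglik x w nu mu S /\
  (negloglik x w nu mu' S' = negloglik x w nu mu S -> mu' = mu /\ S' = S).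
Proof.
move=> mu' S' nu0 SP SP'.
pose g i := w i * gamma x nu mu S i; pose a := \sum_i g i.
have g0 i : 0 < g i by rewrite mulr_gt0 // gamma_gt0.
have a0 : 0 < a.
  rewrite lt_neqAle sumr_ge0 ?andbT; last by move=> i _; exact: ltW.
  (* A zero sum would make every positive [g i] vanish, so there would be no index at all, against
     [w_sum1]. *)
  apply/eqP => /esym/eqP; rewrite psumr_eq0 => [/allP g_0|i _]; last exact: ltW.
  have : \sum_i w i = 0.
    apply: big1 => i _; have := g_0 i; rewrite mem_index_enum => /(_ isT).
    by rewrite gt_eqF.
  by rewrite w_sum1 => /eqP; rewrite oner_eq0.
have an0 : a != 0 by rewrite gt_eqF.
have D0 i : 0 < nu + delta x mu S i by rewrite ltr_wpDr // delta_ge0.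
have D'0 i : 0 < nu + delta x mu' S' i by rewrite ltr_wpDr // delta_ge0.
have centered : \sum_i g i *: (x i - mu') = 0.
  under eq_bigr do rewrite scalerBr.
  by rewrite sumrB -scaler_suml /mu' /next_mu -/a scalerA mulfV // scale1r subrr.
have aS' : \sum_i g i *: ((x i - mu') *m (x i - mu')^T) = a *: S'.
  by rewrite /S' /next_Sigma -/mu' -/a scalerA mulfV // scale1r.
have sumD' : \sum_i g i * delta x mu' S' i = a * d%:R.
  by rewrite sum_weighted_delta aS' -scalemxAr mulVmx ?SPD_unitmx // mxtraceZ mxtrace1.
pose q := ((mu' - mu)^T *m invmx S *m (mu' - mu)) 0 0.
pose T := \tr (invmx S *m (a *: S')).
have [q0 qeq0] := SPD_inv_form_ge0 (mu' - mu) SP; rewrite -/q in q0 qeq0.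
have sumD : \sum_i g i * delta x mu S i = T + a * q.
  rewrite sum_weighted_delta (scatter_shift _ centered) aS' mulmxDr mxtraceD.
  rewrite -/a -[in X in _ + X]scalemxAr mxtraceZ; congr (_ + _ * _).
  by rewrite mulmxA mxtrace_mulC mulmxA /mxtrace big_ord1.
have sumgD : \sum_i g i * (nu + delta x mu S i) = nu + d%:R.
  transitivity (\sum_i w i * (nu + d%:R)); last by rewrite -mulr_suml w_sum1 mul1r.
  apply: eq_bigr => i _.
  by rewrite /g /gamma; field; rewrite gt_eqF.
have TE : T = nu + d%:R - nu * a - a * q.
  rewrite -sumgD; under [in RHS]eq_bigr do rewrite mulrDr.
  by rewrite big_split /= sumD -mulr_suml -/a; ring.
have aSP' : SPD (a *: S').
  apply: SPD_intro; first by rewrite linearZ /= (SPD_tr SP').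
  move=> v v0; rewrite -scalemxAr -scalemxAl mxE mulr_gt0 //.
  exact: SP'.2.
have [] := ln_det_sub_le SP aSP'; rewrite -/T.
have dS0 := SPD_det_gt0 SP; have dS'0 := SPD_det_gt0 SP'.
rewrite detZ lnM ?posrE ?exprn_gt0 // lnXn // -mulr_natl => det_le det_eq.
have nd0 : 0 < nu + d%:R by rewrite ltr_wpDr.
pose rr i := (nu + delta x mu' S' i) / (nu + delta x mu S i).
have rr0 i : 0 < rr i by rewrite divr_gt0.
have rr_sum : \sum_i w i * rr i = a.
  (* The factor [nu + d%:R] turns the weights into the [g i], for which [sumD'] is available. *)
  apply: (mulfI (lt0r_neq0 nd0)).
  have -> : (nu + d%:R) * \sum_i w i * rr i = \sum_i g i * (nu + delta x mu' S' i).
    rewrite mulr_sumr; apply: eq_bigr => i _.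
    by rewrite /g /gamma /rr; field; rewrite gt_eqF.
  under eq_bigr do rewrite mulrDr.
  by rewrite big_split /= sumD' -mulr_suml -/a; ring.
(* The tangent to [ln] at [a], the mean of the ratios [rr i], is averaged with the weights [w]. *)
have jensen : \sum_i w i * ln (nu + delta x mu' S' i)
    - \sum_i w i * ln (nu + delta x mu S i) <= ln a.
  rewrite -sumrB; apply: (@le_trans _ _ (\sum_i w i * (ln a + (rr i / a - 1)))).
    apply: ler_sum => i _; rewrite -mulrBr ler_pM2l // -ln_div ?posrE // -/(rr i).
    rewrite -lerBlDl -ln_div ?posrE //.
    by apply: ln_leB1; rewrite divr_gt0.
  rewrite (eq_bigr (fun i => w i * (ln a - 1) + a^-1 * (w i * rr i))).
    by rewrite big_split /= -mulr_suml -mulr_sumr rr_sum w_sum1 mulVf // mul1r subrK.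
  by move=> i _; field.
have lna := ln_leB1 a0.
have aq0 : 0 <= a * q by rewrite mulr_ge0 // ltW.
rewrite TE in det_le det_eq.
have jensen' : (d%:R + nu) * (\sum_i w i * ln (nu + delta x mu' S' i)
    - \sum_i w i * ln (nu + delta x mu S i)) <= (d%:R + nu) * ln a.
  by rewrite ler_pM2l // addrC.
have lna' : nu * ln a <= nu * (a - 1) by rewrite ler_pM2l.
have diffE : negloglik x w nu mu' S' - negloglik x w nu mu S =
    (d%:R + nu) * (\sum_i w i * ln (nu + delta x mu' S' i)
    - \sum_i w i * ln (nu + delta x mu S i)) + (ln (\det S') - ln (\det S)).
  rewrite /negloglik; move: (ln (Gamma ((d%:R + nu) / 2))) (ln (Gamma (nu / 2))) => G1 G2.
  ring.
move: (negloglik x w nu mu' S') (negloglik x w nu mu S) diffE => L' L diffE.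
move: (\sum_i w i * ln (nu + delta x mu' S' i) - _) jensen' diffE => J jensen' diffE.
move: (ln (\det S)) (ln (\det S')) det_le det_eq diffE => lS lS' det_le det_eq diffE.
split; first by move: det_le jensen' lna'; lra.
move=> eqL.
(* Equality makes every bound tight: the one on [ln a] gives [a = 1], the term [a * q] gives
   [mu' = mu], and the determinant bound gives [a *: S' = S]. *)
have lnaE : nu * ln a = nu * (a - 1) by move: det_le jensen' lna' eqL; lra.
have a1 : a = 1 by apply: ln_eqB1 => //; apply: (mulfI (lt0r_neq0 nu0)).
have aq_0 : a * q = 0 by move: det_le jensen' lna' eqL; lra.
have muE : mu' = mu.
  by apply/eqP; rewrite -subr_eq0; apply/eqP/qeq0; move: aq_0; rewrite a1 mul1r.
split=> //.
suff : a *: S' = S by rewrite a1 scale1r.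
by apply: det_eq; move: det_le jensen' lna' eqL; lra.
Qed.

End LocationScatter.

(* [is_deriveD] and friends are stated for sums of functions in the ring of
   functions; these versions unify with pointwise expressions. *)
Section PointwiseDerivatives.
Context {R : realType}.
Implicit Types (f g : R -> R) (x a b : R).

Lemma is_derive1_add f g x a b : is_derive x 1 f a -> is_derive x 1 g b ->
  is_derive x 1 (fun t => f t + g t) (a + b).
Proof. exact: is_deriveD. Qed.

Lemma is_derive1_opp f x a : is_derive x 1 f a ->
  is_derive x 1 (fun t => - f t) (- a).
Proof. exact: is_deriveN. Qed.

Lemma is_derive1_mul f g x a b : is_derive x 1 f a -> is_derive x 1 g b ->
  is_derive x 1 (fun t => f t * g t) (a * g x + f x * b).
Proof.
move=> df dg; apply: (@is_derive_eq _ _ _ (f * g) x 1 _ _ (is_deriveM df dg)).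
by rewrite /GRing.scale /= addrC [g x * a]mulrC.
Qed.

Lemma is_derive1_scale f x c a : is_derive x 1 f a ->
  is_derive x 1 (fun t => c * f t) (c * a).
Proof. exact: is_deriveZ. Qed.

Lemma is_derive1_inv f x a : f x != 0 -> is_derive x 1 f a ->
  is_derive x 1 (fun t => (f t)^-1) (- a / f x ^+ 2).
Proof.
move=> f0 df; apply: (is_derive_eq (is_deriveV f0 df)).
by rewrite /GRing.scale /= mulrC mulrN mulNr.
Qed.

Lemma is_derive1_chain f g x a b : is_derive (g x) 1 f a -> is_derive x 1 g b ->
  is_derive x 1 (fun t => f (g t)) (a * b).
Proof. exact: is_derive1_comp. Qed.

(** Shifts are also handled by this lemma, hence the terms of the form [1 * t + b] further on. *)
Lemma is_derive1_affine x a b : is_derive x 1 (fun t => a * t + b) a.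
Proof.
have d1 : is_derive x 1 (fun t => a * t) (a * 1).
  by apply: is_derive1_scale; exact: is_derive_id.
have d2 : is_derive x 1 (fun=> b) 0 by exact: is_derive_cst.
by apply: (is_derive_eq (is_derive1_add d1 d2)); rewrite mulr1 addr0.
Qed.

Lemma is_derive1_sum n (F : 'I_n -> R -> R) (dF : 'I_n -> R) x :
  (forall i, is_derive x 1 (F i) (dF i)) ->
  is_derive x 1 (fun t => \sum_(i < n) F i t) (\sum_(i < n) dF i).
Proof.
move=> dFi; rewrite (_ : (fun t => _) = \sum_(i < n) F i).
  exact: is_derive_sum.
by apply/funext => t; rewrite fct_sumE.
Qed.

Lemma is_derive1_continuous f x a : is_derive x 1 f a -> {for x, continuous f}.
Proof.
by case=> df _; apply: differentiable_continuous; exact/derivable1_diffP.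
Qed.

End PointwiseDerivatives.

(** * The Gamma and digamma functions *)

Section ImproperIntegral.
Context {R : realType}.
Local Notation mu := (@lebesgue_measure R).

(** Compact intervals avoiding both ends of the half line. The offset 2 makes the endpoints distinct
    already for [k = 0], as the fundamental theorem of calculus requires. *)
Definition exhaust (k : nat) : set R := `[(k.+2%:R)^-1, k.+2%:R]%classic.

Lemma exhaust_homo : {homo exhaust : k m / (k <= m)%N >-> (k <= m)%O}.
Proof.
move=> k m km; apply/subsetPset => t; rewrite /exhaust /= !in_itv /= => /andP[lt_ gt_].
apply/andP; split; last by rewrite (le_trans gt_) // ler_nat !ltnS.
by rewrite (le_trans _ lt_) // lef_pV2 ?posrE ?ltr0n // ler_nat !ltnS.
Qed.

Lemma bigcup_exhaust : \bigcup_k exhaust k = `](0 : R), +oo[%classic.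
Proof.
apply/seteqP; split=> t /=.
  move=> [k _]; rewrite /exhaust /= !in_itv /= andbT => /andP[+ _].
  by apply: lt_le_trans; rewrite invr_gt0 ltr0n.
rewrite in_itv /= andbT => t0.
exists (Num.truncn (t + t^-1)) => //; rewrite /exhaust /= in_itv /=.
set k := Num.truncn _.
have tk : t + t^-1 < k.+1%:R by rewrite truncnS_gt // ltW // addr_gt0 // invr_gt0.
have kk : k.+1%:R <= k.+2%:R :> R by rewrite ler_nat.
have ti0 : 0 < t^-1 by rewrite invr_gt0.
apply/andP; split; last by lra.
by rewrite -[t]invrK lef_pV2 ?posrE ?ltr0n //; lra.
Qed.

Lemma exhaust_sub k : exhaust k `<=` `](0 : R), +oo[%classic.
Proof. by rewrite -bigcup_exhaust; exact: bigcup_sup. Qed.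

Lemma measurable_exhaust k : measurable (exhaust k).
Proof. exact: measurable_itv. Qed.

(** By monotone convergence, the uniform bound passes to the integral over the half line. *)
Lemma ge0_integrable_exhaust (f : R -> R) (M : R) :
  measurable_fun `](0 : R), +oo[ f -> (forall t, 0 < t -> 0 <= f t) ->
  (forall k, (\int[mu]_(t in exhaust k) (f t)%:E <= M%:E)%E) ->
  mu.-integrable `]0, +oo[ (EFin \o f).
Proof.
move=> mf f0 fM; apply/integrableP; split; first exact/measurable_EFinP.
under eq_integral => t.
  rewrite inE /= in_itv /= andbT => t0; rewrite ger0_norm ?f0 //; over.
have cvgI : ((\int[mu]_(t in exhaust k) (f t)%:E) @[k --> \oo]
    --> \int[mu]_(t in `]0%R, +oo[) (f t)%:E)%E.
  rewrite -bigcup_exhaust; apply: ge0_nondecreasing_set_cvg_integral.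
  - exact: exhaust_homo.
  - exact: measurable_exhaust.
  - by move=> k; apply/measurable_EFinP; apply: measurable_funS mf => //; exact: exhaust_sub.
  - by move=> k t /exhaust_sub /=; rewrite in_itv /= andbT lee_fin => /f0.
apply: (@le_lt_trans _ _ M%:E); last exact: ltry.
rewrite -(cvg_lim _ cvgI) //; apply: lime_le; first by apply/cvg_ex; eexists; exact: cvgI.
exact: nearW.
Qed.

Lemma ge0_Rintegral_exhaust_cvg (f : R -> R) :
  mu.-integrable `]0, +oo[ (EFin \o f) -> (forall t, 0 < t -> 0 <= f t) ->
  \int[mu]_(t in exhaust k) f t @[k --> \oo] --> \int[mu]_(t in `]0, +oo[) f t.
Proof.
move=> fi f0; rewrite /Rintegral; apply: fine_cvg.
rewrite fineK; last exact: integrable_fin_num.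
rewrite -bigcup_exhaust; apply: ge0_nondecreasing_set_cvg_integral.
- exact: exhaust_homo.
- exact: measurable_exhaust.
- move=> k; apply: (measurable_funS _ (@exhaust_sub k)) => //.
  exact: measurable_int fi.
- by move=> k t /exhaust_sub /=; rewrite in_itv /= andbT lee_fin => /f0.
Qed.

Lemma integral_exhaust_FTC (F f : R -> R) (k : nat) :
  (forall t : R, 0 < t -> is_derive t 1 F (f t)) ->
  (forall t : R, 0 < t -> {for t, continuous f}) ->
  (\int[mu]_(t in exhaust k) (f t)%:E = (F k.+2%:R - F (k.+2%:R)^-1)%:E)%E.
Proof.
move=> dF cf; rewrite /exhaust EFinB.
have k0 : 0 < (k.+2%:R)^-1 :> R by rewrite invr_gt0 ltr0n.
have kl : (k.+2%:R)^-1 < k.+2%:R :> R.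
  by rewrite (@lt_trans _ _ 1) ?invf_lt1 ?ltr0n ?ltr1n.
have cF t : 0 < t -> {for t, continuous F}.
  move=> t0; apply: differentiable_continuous; apply/derivable1_diffP.
  by have [] := dF _ t0.
apply: continuous_FTC2 => //.
- apply: continuous_in_subspaceT => t; rewrite inE /= in_itv /= => /andP[kt _].
  by apply: cf; exact: lt_le_trans kt.
- split.
  + move=> t; rewrite in_itv /= => /andP[kt _].
    by have [] := dF _ (lt_trans k0 kt).
  + by apply: cvg_at_right_filter; exact: cF.
  + by apply: cvg_at_left_filter; apply: cF; exact: lt_trans kl.
- move=> t; rewrite in_itv /= => /andP[kt _]; rewrite derive1E.
  by have [] := dF _ (lt_trans k0 kt).
Qed.

End ImproperIntegral.

(** * Convergence, positivity and recurrence of Euler's integral *)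

Section GammaFunction.
Context {R : realType}.
Local Notation mu := (@lebesgue_measure R).
Implicit Types s t z : R.

Definition euler_kernel (z t : R) : R := t `^ (z - 1) * expR (- t).

Lemma euler_kernel_ge0 z t : 0 <= euler_kernel z t.
Proof. by rewrite mulr_ge0 ?powR_ge0 ?expR_ge0. Qed.

Lemma measurable_euler_kernel z (D : set R) : measurable_fun D (euler_kernel z).
Proof.
apply: measurable_funTS; apply: measurable_funM; first exact: measurable_powR.
by apply: measurableT_comp => //; exact: measurable_expR.
Qed.

Lemma continuous_powR_gt0 z t : 0 < t -> {for t, continuous (@powR R ^~ z)}.
Proof.
move=> t0; apply: differentiable_continuous; apply/derivable1_diffP.
by have [] := is_derive1_powR z t0.
Qed.

(** The constant is the exponential of the maximum of [s * ln t - t / 2], attained at [t = 2 * s];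
    the bound is the tangent to [ln] at that point. *)
Lemma powR_le_expR s t : 0 < s -> 0 < t ->
  t `^ s <= expR (s * ln (2 * s) - s) * expR (t / 2).
Proof.
move=> s0 t0; rewrite /powR gt_eqF // -expRD ler_expR.
have s2 : 0 < 2 * s by rewrite mulr_gt0.
have := @ln_leB1 _ (t / (2 * s)); rewrite divr_gt0 // => /(_ isT).
rewrite ln_div ?posrE // lerBlDr => H.
have : s * ln t <= s * (t / (2 * s) - 1 + ln (2 * s)) by rewrite ler_pM2l.
move/le_trans; apply; rewrite le_eqVlt; apply/orP; left; apply/eqP.
by field; rewrite gt_eqF.
Qed.

(* The bound is a multiple of the derivative of the bounded function
   [1 - 1 / (1 + t `^ s)], hence integrable. *)
Lemma euler_kernel_le s : 0 < s -> exists2 C : R, 0 <= C &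
  forall t, 0 < t ->
    euler_kernel s t <= C * (s * t `^ (s - 1) * (1 + t `^ s) ^- 2).
Proof.
(* [K * expR (t / 2)] dominates the denominator [1 + t ^ s]; squaring this absorbs [expR (- t)]. *)
move=> s0; pose K := 1 + expR (s * ln (2 * s) - s).
have K0 : 0 <= K by rewrite addr_ge0 ?expR_ge0.
exists (K ^+ 2 / s); first by rewrite divr_ge0 ?sqr_ge0 // ltW.
move=> t t0; rewrite /euler_kernel.
have p0 : 0 < 1 + t `^ s by rewrite ltr_pwDl // powR_ge0.
have e1 : 1 <= expR (t / 2) by rewrite -expR0 ler_expR divr_ge0 // ltW.
have pK : 1 + t `^ s <= K * expR (t / 2).
  by rewrite mulrDl mul1r lerD // powR_le_expR.
have -> : K ^+ 2 / s * (s * t `^ (s - 1) / (1 + t `^ s) ^+ 2) =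
    t `^ (s - 1) * (K / (1 + t `^ s)) ^+ 2 by field; rewrite !gt_eqF.
rewrite ler_wpM2l ?powR_ge0 //.
have -> : expR (- t) = expR (- (t / 2)) ^+ 2.
  by rewrite -expRM_natl; congr expR; field.
rewrite ler_sqr ?nnegrE ?expR_ge0 ?divr_ge0 // ?(ltW p0) //.
by rewrite expRN ler_pdivlMr // mulrC ler_pdivrMr ?expR_gt0.
Qed.

Lemma euler_kernel_integrable z : 0 < z ->
  mu.-integrable `]0, +oo[ (EFin \o euler_kernel z).
Proof.
move=> z0; have [C C0 leC] := euler_kernel_le z0.
pose h t := z * t `^ (z - 1) * (1 + t `^ z) ^- 2.
pose H t : R := - (1 + t `^ z)^-1.
have p0 t : 0 < 1 + t `^ z by rewrite ltr_pwDl // powR_ge0.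
have dH t : 0 < t -> is_derive t 1 H (h t).
  move=> t0; rewrite /H.
  have d1 : is_derive t 1 (fun t => 1 + t `^ z) (0 + z * t `^ (z - 1)).
    by apply: is_derive1_add; exact: is_derive1_powR.
  have d2 := is_derive1_opp
    (@is_derive1_inv _ (fun t => 1 + t `^ z) _ _ (lt0r_neq0 (p0 t)) d1).
  apply: (is_derive_eq d2); rewrite /h add0r.
  by field; rewrite gt_eqF.
have ch t : 0 < t -> {for t, continuous h}.
  move=> t0; have c1 : {for t, continuous (fun t => 1 + t `^ z)}.
    by apply: cvgD; [exact: cvg_cst | exact: continuous_powR_gt0].
  apply: cvgM.
    by apply: cvgM; [exact: cvg_cst | exact: continuous_powR_gt0].
  apply: cvgV; first by rewrite expf_neq0 // gt_eqF.
  by apply: cvgM.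
apply: (@ge0_integrable_exhaust _ _ (C * 1)).
- exact: measurable_euler_kernel.
- by move=> t _; exact: euler_kernel_ge0.
move=> k.
(* The primitive [H] varies by at most 1, which bounds the integrals of [h] uniformly in [k]. *)
have H1 t : 0 < - H t <= 1.
  by rewrite /H opprK invr_gt0 p0 invf_le1 // lerDl powR_ge0.
apply: (@le_trans _ _ (\int[mu]_(t in exhaust k) (C%:E * (h t)%:E))%E).
  apply: ge0_le_integral => //.
  - exact: measurable_exhaust.
  - by move=> t _; rewrite lee_fin euler_kernel_ge0.
  - by apply/measurable_EFinP; exact: measurable_euler_kernel.
  - apply: (measurable_funS _ (@exhaust_sub _ k)) => //.
    apply/measurable_EFinP; apply: measurable_funM => //.
    apply: open_continuous_measurable_fun; first exact: interval_open.
    by move=> t; rewrite inE /= in_itv /= andbT; exact: ch.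
  - move=> t; rewrite /exhaust /= in_itv /= => /andP[kt _].
    by rewrite -EFinM lee_fin leC // (lt_le_trans _ kt).
under eq_integral do rewrite -EFinM.
have dCH t : 0 < t -> is_derive t 1 (fun t => C * H t) (C * h t).
  by move=> /dH ?; exact: is_derive1_scale.
have cCh t : 0 < t -> {for t, continuous (fun t => C * h t)}.
  by move=> /ch ?; apply: cvgM; first exact: cvg_cst.
rewrite (integral_exhaust_FTC k dCH cCh) lee_fin -mulrBr ler_wpM2l //.
have := H1 k.+2%:R; have := H1 (k.+2%:R)^-1; lra.
Qed.

Local Notation I0 := (`](0 : R), +oo[%classic).

Lemma integrable_addR (f g : R -> R) : mu.-integrable I0 (EFin \o f) ->
  mu.-integrable I0 (EFin \o g) ->
  mu.-integrable I0 (EFin \o (fun t => f t + g t)).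
Proof.
move=> fi gi; rewrite (_ : EFin \o _ = (EFin \o f \+ (EFin \o g))%E) //.
exact: integrableD.
Qed.

Lemma integrable_scaleR (f : R -> R) c : mu.-integrable I0 (EFin \o f) ->
  mu.-integrable I0 (EFin \o (fun t => c * f t)).
Proof.
move=> fi; rewrite (_ : EFin \o _ = (fun t => c%:E * (EFin \o f) t)%E) //.
exact: integrableZl.
Qed.

Lemma Gamma_gt0 z : 0 < z -> 0 < Gamma z.
Proof.
(* [c] is a lower bound of the integrand on [[1, 2]], where [ln t] lies between 0 and 1 and
   [t <= 2]; this interval has measure 1. *)
move=> z0; pose c : R := expR (- (`|z - 1| + 2)).
have c0 : 0 < c by exact: expR_gt0.
have int0 := euler_kernel_integrable z0.
suff le_ : (c%:E <= \int[mu]_(t in I0) (euler_kernel z t)%:E)%E.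
  rewrite -lte_fin (lt_le_trans (y := c%:E)) ?lte_fin //.
  by apply: le_trans le_ _; rewrite /Gamma /Rintegral fineK //; exact: integrable_fin_num.
have mD : measurable `[(1 : R), 2] by exact: measurable_itv.

apply: (@le_trans _ _ (\int[mu]_(t in `[1%R, 2%R]) (euler_kernel z t)%:E)%E).
  have muD : mu (`[(1 : R), 2]%classic) = 1%E.
    rewrite lebesgue_measure_itv /= lte_fin ltr1n /= -EFinB; congr EFin; ring.
  rewrite -[leLHS]mule1 -muD -integral_cst //; apply: ge0_le_integral => //.
  - by move=> t _; rewrite lee_fin ltW.
  - by apply/measurable_EFinP; exact: measurable_euler_kernel.
  - move=> t /=; rewrite in_itv /= => /andP[t1 t2]; rewrite lee_fin.
    have t0 : 0 < t by exact: lt_le_trans t1.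
    rewrite /euler_kernel /powR gt_eqF // -expRD ler_expR opprD lerD ?lerN2 //.
    have lt0 : 0 <= ln t by rewrite ln_ge0.
    have lt1 : ln t <= 1 by have := ln_leB1 t0; lra.
    apply: (@le_trans _ _ (- `|(z - 1) * ln t|)); last by rewrite lerNl -normrN ler_norm.
    by rewrite lerN2 normrM ler_piMr // ger0_norm.
apply: ge0_subset_integral => //.
- by apply/measurable_EFinP; exact: measurable_euler_kernel.
- by move=> t _; rewrite lee_fin euler_kernel_ge0.
- by move=> t /=; rewrite !in_itv /= andbT => /andP[t1 _]; exact: lt_le_trans t1.
Qed.

Lemma euler_kernelS z t : 0 < t -> euler_kernel (z + 1) t = t * euler_kernel z t.
Proof.
move=> t0; rewrite /euler_kernel mulrA; congr (_ * _).
rewrite -[t in t * _]powRr1 ?ltW // -powRD; last by rewrite (lt0r_neq0 t0) implybT.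
by congr (_ `^ _); ring.
Qed.

(** Integration by parts: [f] is the derivative of [F], which tends to 0 at both ends of the half
    line. *)
Lemma GammaS z : 0 < z -> Gamma (z + 1) = z * Gamma z.
Proof.
move=> z0; have z10 : 0 < z + 1 by rewrite addr_gt0.
have int0 := euler_kernel_integrable z0.
have int1 := euler_kernel_integrable z10.
pose F t : R := t `^ z * expR (- t).
pose f t := z * euler_kernel z t - euler_kernel (z + 1) t.
have dF t : 0 < t -> is_derive t 1 F (f t).
  move=> t0.
  have d1 := is_derive1_powR z t0.
  have d2 : is_derive t 1 (fun t => expR (- t)) (expR (- t) * - 1).
    by apply: (is_derive1_chain (f := @expR R)); apply: is_derive1_opp; exact: is_derive_id.
  apply: (is_derive_eq (is_derive1_mul d1 d2)).
  by rewrite /f /euler_kernel addrK; ring.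
have cker s t : 0 < t -> {for t, continuous (euler_kernel s)}.
  move=> t0; apply: cvgM; first exact: continuous_powR_gt0.
  apply: continuous_comp; last exact: continuous_expR.
  by apply: cvgN.
have cf t : 0 < t -> {for t, continuous f}.
  move=> t0; apply: cvgB; last exact: cker.
  by apply: cvgM; [exact: cvg_cst | exact: cker].
have sub k (g : R -> R) : mu.-integrable I0 (EFin \o g) ->
    mu.-integrable (exhaust k) (EFin \o g).
  by apply: integrableS => //; [exact: measurable_exhaust | exact: exhaust_sub].
have FE k : F k.+2%:R - F (k.+2%:R)^-1 =
    z * (\int[mu]_(t in exhaust k) euler_kernel z t)
    - \int[mu]_(t in exhaust k) euler_kernel (z + 1) t.
  rewrite -RintegralZl //; [|exact: measurable_exhaust|exact: sub].
  rewrite -RintegralB //; [|exact: measurable_exhaust|exact/sub/integrable_scaleR|exact: sub].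
  by rewrite /Rintegral (integral_exhaust_FTC k dF cf).
have lim1 : F k.+2%:R - F (k.+2%:R)^-1 @[k --> \oo] --> z * Gamma z - Gamma (z + 1).
  under eq_fun do rewrite FE.
  apply: cvgB; last by apply: ge0_Rintegral_exhaust_cvg => // t _; exact: euler_kernel_ge0.
  apply: cvgM; first exact: cvg_cst.
  by apply: ge0_Rintegral_exhaust_cvg => // t _; exact: euler_kernel_ge0.
have inv0 : (k.+2%:R)^-1 @[k --> \oo] --> (0 : R).
  by have := @cvg_harmonic R; rewrite -cvg_shiftS.
have lim2 : F k.+2%:R - F (k.+2%:R)^-1 @[k --> \oo] --> (0 : R).
  rewrite -[X in _ --> X]subr0; apply: cvgB.
    (* By [powR_le_expR], [F] at [t] is at most a constant times [expR (- (t / 2))], hence at most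
       [C / t] because [t / 2 <= expR (t / 2)]. *)
    pose C := expR (z * ln (2 * z) - z) * 2.
    apply: (@squeeze_cvgr _ _ _ _ (cst 0) (fun k => C * (k.+2%:R)^-1)).
    - apply: nearW => k /=; rewrite /F mulr_ge0 ?powR_ge0 ?expR_ge0 //=.
      have k0 : 0 < k.+2%:R :> R by rewrite ltr0n.
      have := powR_le_expR z0 k0; set e := expR (_ - z) => le1.
      apply: (@le_trans _ _ (e * expR (k.+2%:R / 2) * expR (- k.+2%:R))).
        by rewrite ler_wpM2r ?expR_ge0.
      rewrite -mulrA -expRD /C -/e -mulrA ler_wpM2l ?expR_ge0 //.
      rewrite (_ : k.+2%:R / 2 - k.+2%:R = - (k.+2%:R / 2)); last by field.
      rewrite expRN -[X in _ <= X]invrK lef_pV2 ?posrE ?expR_gt0 ?invr_gt0 ?mulr_gt0 ?invr_gt0 //.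
      rewrite invfM invrK mulrC.
      by apply: le_trans (expR_ge1Dx _); rewrite lerDr.
    - exact: cvg_cst.
    - by rewrite -[X in _ --> X](mulr0 C); apply: cvgM; first exact: cvg_cst.
  apply: (@squeeze_cvgr _ _ _ _ (cst 0) (fun k => (k.+2%:R)^-1 `^ z)).
  - apply: nearW => k /=; rewrite /F mulr_ge0 ?powR_ge0 ?expR_ge0 //=.
    by rewrite ler_piMr ?powR_ge0 // expR_le1 oppr_le0 invr_ge0.
  - exact: cvg_cst.
  - have /cvg_at_rightP/(_ (fun k => (k.+2%:R)^-1)) := powR_cvg0 z0; apply.
    by split=> // k; rewrite invr_gt0 ltr0n.
by apply/esym/eqP; rewrite -subr_eq0; apply/eqP; exact: cvg_unique lim1 lim2.
Qed.

(** * Differentiation of Euler's integral in its parameter *)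

Lemma is_derive_euler_kernel z t : 0 < t ->
  is_derive z 1 (euler_kernel ^~ t) (ln t * euler_kernel z t).
Proof.
move=> t0; have E s : euler_kernel s t = expR (ln t * s + - ln t) * expR (- t).
  rewrite /euler_kernel /powR gt_eqF //; congr (expR _ * _); ring.
rewrite (_ : euler_kernel^~ t = fun s => expR (ln t * s + - ln t) * expR (- t)).
  have d1 := @is_derive1_chain _ (@expR R) (fun s => ln t * s + - ln t) _ _ _
    (is_derive_expR _) (is_derive1_affine z (ln t) (- ln t)).
  have d2 := is_derive_cst (expR (- t)) z 1.
  apply: (is_derive_eq (is_derive1_mul d1 d2)); rewrite E /cst; ring.
by apply/funext => s; exact: E.
Qed.

(** From [y <= expR y] at [y = e * ln t] and at its opposite. It trades the logarithm for small
    shifts of the exponent. *)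
Lemma normr_ln_le (e t : R) : 0 < e -> 0 < t -> `|ln t| <= e^-1 * (t `^ e + t `^ (- e)).
Proof.
move=> e0 t0; rewrite mulrC ler_pdivlMr // -[X in _ * X]gtr0_norm // -normrM.
rewrite /powR gt_eqF // mulNr [e * _]mulrC.
have ub (y : R) : y <= expR y by apply: le_trans (expR_ge1Dx _); rewrite lerDr.
rewrite ler_norml; apply/andP; split.
  by rewrite lerNl; apply: le_trans (ub _) _; rewrite lerDr expR_ge0.
by apply: le_trans (ub _) _; rewrite lerDl expR_ge0.
Qed.

(** Powers of [t] are monotone in the exponent, in a direction that depends on whether [t <= 1]; the
    sum covers both cases. *)
Lemma powR_le_add (a b s t : R) : 0 < t -> a <= s <= b ->
  t `^ s <= t `^ a + t `^ b.
Proof.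
move=> t0 /andP[as_ sb]; have [t1|/ltW t1] := leP t 1.
  apply: (@le_trans _ _ (t `^ a)); last by rewrite lerDl powR_ge0.
  by apply: ger_powR => //; rewrite t0.
apply: (@le_trans _ _ (t `^ b)); last by rewrite lerDr powR_ge0.
exact: ler_powR.
Qed.

(* A dominating function for the [z]-derivative of the Gamma integrand, valid
   for the parameter in [`]z / 2, 2 * z[]. *)
Definition euler_kernel_majorant z t : R :=
  (z / 4)^-1 * ((euler_kernel (z / 2 + z / 4) t + euler_kernel (z * 2 + z / 4) t)
              + (euler_kernel (z / 2 - z / 4) t + euler_kernel (z * 2 - z / 4) t)).

Lemma euler_kernel_majorant_integrable z : 0 < z ->
  mu.-integrable I0 (EFin \o euler_kernel_majorant z).
Proof.
move=> z0; apply: integrable_scaleR.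
(* The shift [z / 4] keeps all four parameters positive; the smallest is [z / 4] itself. *)
by do 2?[apply: integrable_addR]; apply: euler_kernel_integrable; lra.
Qed.

Lemma norm_ln_euler_kernel_le z s t : 0 < z -> z / 2 < s < z * 2 -> 0 < t ->
  `|ln t * euler_kernel s t| <= euler_kernel_majorant z t.
Proof.
move=> z0 /andP[zs sz] t0; have e0 : 0 < z / 4 by rewrite divr_gt0.
rewrite normrM (ger0_norm (euler_kernel_ge0 s t)).
apply: (@le_trans _ _ ((z / 4)^-1 * (t `^ (z / 4) + t `^ (- (z / 4))) *
    ((t `^ (z / 2 - 1) + t `^ (z * 2 - 1)) * expR (- t)))).
  apply: ler_pM => //; first exact: euler_kernel_ge0.
    exact: normr_ln_le.
  rewrite ler_wpM2r ?expR_ge0 // powR_le_add //; lra.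
rewrite le_eqVlt; apply/orP; left; apply/eqP; rewrite /euler_kernel_majorant.
have powD a b : t `^ (a + b - 1) = t `^ b * t `^ (a - 1).
  rewrite -powRD; last by rewrite (lt0r_neq0 t0) implybT.
  by congr (_ `^ _); ring.
by rewrite /euler_kernel !powD; ring.
Qed.

Lemma ln_euler_kernel_integrable z : 0 < z ->
  mu.-integrable I0 (EFin \o (fun t => ln t * euler_kernel z t)).
Proof.
move=> z0; apply: le_integrable (euler_kernel_majorant_integrable z0) => //.
  apply/measurable_EFinP; apply: measurable_funM; last exact: measurable_euler_kernel.
  by apply: measurable_funTS; exact: measurable_ln.
move=> t /=; rewrite in_itv /= andbT => t0.
rewrite lee_fin; apply: le_trans (ler_norm _).
by apply: norm_ln_euler_kernel_le => //; lra.
Qed.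

Lemma GammaE z : Gamma z = \int[mu]_(t in I0) euler_kernel z t.
Proof. by []. Qed.

(** The parameter is confined to a neighbourhood of [z] away from 0, on which one integrable
    majorant dominates all the partial derivatives. *)
Lemma is_derive_Gamma z : 0 < z ->
  is_derive z 1 Gamma (\int[mu]_(t in I0) (ln t * euler_kernel z t)).
Proof.
move=> z0.
have part s t : 0 < t -> partial1of2 euler_kernel s t = ln t * euler_kernel s t.
  by move=> t0; rewrite partial1of2E; case: (is_derive_euler_kernel s t0).
have Iz : `]z / 2, z * 2[%classic z by rewrite /= in_itv /=; lra.
have ker_int s : `]z / 2, z * 2[%classic s -> mu.-integrable I0 (EFin \o euler_kernel s).
  by rewrite /= in_itv /= => /andP[zs _]; apply: euler_kernel_integrable; lra.
have ker_der s t : `]z / 2, z * 2[%classic s -> I0 t -> derivable (euler_kernel^~ t) s 1.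
  by move=> _; rewrite /= in_itv /= andbT => /(is_derive_euler_kernel s)[].
have G0 t : 0 <= euler_kernel_majorant z t.
  by rewrite mulr_ge0 ?invr_ge0 ?divr_ge0 ?addr_ge0 ?euler_kernel_ge0 // ltW.
have dom s t : `]z / 2, z * 2[%classic s -> I0 t ->
    `|partial1of2 euler_kernel s t| <= euler_kernel_majorant z t.
  rewrite /= !in_itv /= andbT => zs t0; rewrite part //.
  exact: norm_ln_euler_kernel_le.
have mI : measurable (I0 : set (measurableTypeR R)) by exact: measurable_itv.
have Gint := euler_kernel_majorant_integrable z0.
apply: DeriveDef.
  exact: (derivable_under_integral mI Iz ker_int ker_der G0 Gint dom).
rewrite -derive1E (differentiation_under_integral mI Iz ker_int ker_der G0 Gint dom).
by apply: eq_Rintegral => t; rewrite inE /= in_itv /= andbT => /part ->.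
Qed.

(** * Recurrence and logarithmic bounds for the digamma function *)

Lemma digammaE z : 0 < z ->
  digamma z = (\int[mu]_(t in I0) (ln t * euler_kernel z t)) / Gamma z.
Proof.
by move=> z0; rewrite /digamma derive1E; case: (is_derive_Gamma z0) => _ ->.
Qed.

(** The logarithmic derivative of the recurrence [GammaS]. *)
Lemma digammaS z : 0 < z -> digamma (z + 1) = digamma z + z^-1.
Proof.
move=> z0; have z10 : 0 < z + 1 by rewrite addr_gt0.
have G0 := Gamma_gt0 z0.
have [_ dz] := is_derive_Gamma z0; have [_ dz1] := is_derive_Gamma z10.
have d1 : is_derive z 1 (fun s => Gamma (1 * s + 1)) ('D_1 Gamma (z + 1) * 1).
  apply: is_derive1_chain; last exact: is_derive1_affine.
  by rewrite mul1r dz1; exact: is_derive_Gamma.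
have d2 : is_derive z 1 (fun s => s * Gamma s) (1 * Gamma z + z * 'D_1 Gamma z).
  by apply: is_derive1_mul; rewrite dz; exact: is_derive_Gamma.
(* [GammaS] holds for positive arguments only, so the two functions are compared near [z]. *)
have near_eq : \forall s \near z, Gamma (1 * s + 1) = s * Gamma s.
  by near=> s; rewrite mul1r GammaS //; near: s; exact: lt_nbhsr.
have DE : 'D_1 (fun s => Gamma (1 * s + 1)) z = 'D_1 (fun s => s * Gamma s) z.
  exact: near_eq_derive near_eq.
move: DE; case: d1 => _ ->; case: d2 => _ ->; rewrite mulr1 mul1r => DE.
rewrite /digamma !derive1E GammaS // DE; move: (Gamma z) G0 => G G0.
by move: ('D_1 Gamma z) => D; field; rewrite !lt0r_neq0.
Unshelve. all: by end_near. Qed.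

(* Jensen for the probability density [euler_kernel z t / Gamma z]:
   the tangent line bound [ln t <= ln z + t / z - 1] is integrated. *)
Lemma digamma_le_ln z : 0 < z -> digamma z <= ln z.
Proof.
move=> z0; have z10 : 0 < z + 1 by rewrite addr_gt0.
have G0 := Gamma_gt0 z0; rewrite digammaE // ler_pdivrMr //.
have -> : ln z * Gamma z = \int[mu]_(t in I0)
    ((ln z - 1) * euler_kernel z t + z^-1 * euler_kernel (z + 1) t).
  rewrite RintegralD //; last 2 first.
  - exact/integrable_scaleR/euler_kernel_integrable.
  - exact/integrable_scaleR/euler_kernel_integrable.
  rewrite !RintegralZl //; try exact: euler_kernel_integrable.
  rewrite -!GammaE GammaS //; field; exact: lt0r_neq0.
apply: le_Rintegral => //.
- exact: ln_euler_kernel_integrable.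
- by apply: integrable_addR; exact/integrable_scaleR/euler_kernel_integrable.
move=> t /=; rewrite in_itv /= andbT => t0; rewrite euler_kernelS //.
move: (euler_kernel z t) (euler_kernel_ge0 z t) => K K0.
rewrite mulrA -mulrDl ler_wpM2r //.
have := ln_leB1 (divr_gt0 t0 z0); rewrite ln_div ?posrE // mulrC; lra.
Qed.

(** By [digammaS] the claim is [ln z <= digamma (z + 1)]. The bound [ln z + 1 - z / t <= ln t] is
    integrated against [euler_kernel (z + 1)], whose extra factor [t] cancels the denominator. *)
Lemma digamma_ge_ln z : 0 < z -> ln z - z^-1 <= digamma z.
Proof.
move=> z0; rewrite lerBlDr -digammaS //; have z10 : 0 < z + 1 by rewrite addr_gt0.
have G0 := Gamma_gt0 z10; rewrite digammaE // ler_pdivlMr //.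
have -> : ln z * Gamma (z + 1) = \int[mu]_(t in I0)
    ((ln z + 1) * euler_kernel (z + 1) t + - z * euler_kernel z t).
  rewrite RintegralD //; last 2 first.
  - exact/integrable_scaleR/euler_kernel_integrable.
  - exact/integrable_scaleR/euler_kernel_integrable.
  rewrite !RintegralZl //; try exact: euler_kernel_integrable.
  rewrite -!GammaE GammaS //; ring.
apply: le_Rintegral => //.
- by apply: integrable_addR; exact/integrable_scaleR/euler_kernel_integrable.
- exact: ln_euler_kernel_integrable.
move=> t /=; rewrite in_itv /= andbT => t0; rewrite euler_kernelS //.
move: (euler_kernel z t) (euler_kernel_ge0 z t) => K K0.
rewrite !mulrA -mulrDl ler_wpM2r //.
have := ln_leB1 (divr_gt0 z0 t0); rewrite ln_div ?posrE // => H.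
have : t * (ln z - ln t) <= t * (z / t - 1) by rewrite ler_pM2l.
have -> : t * (z / t - 1) = z - t by field; exact: lt0r_neq0.
lra.
Qed.

End GammaFunction.

(** * Monotonicity of [phi] and of its differences *)

Section Phi.
Context {R : realType}.
Implicit Types (f u : R -> R) (x y z h : R).

Lemma gt0_MVT f df x y : 0 < x -> x < y ->
  (forall z, x <= z -> z <= y -> is_derive z 1 f (df z)) ->
  exists2 z, x < z < y & f y - f x = df z * (y - x).
Proof.
move=> x0 xy dfz; have [||z zxy E] := @MVT _ f df x y xy.
- by move=> z; rewrite in_itv /= => /andP[xz zy]; apply: dfz; exact: ltW.
- apply: continuous_in_subspaceT => z; rewrite inE /= in_itv /= => /andP[xz zy].
  exact: is_derive1_continuous (dfz z xz zy).
by exists z => //; move: zxy; rewrite in_itv.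
Qed.

Lemma derive_lt0_decreasing f df : (forall z, 0 < z -> is_derive z 1 f (df z)) ->
  (forall z, 0 < z -> df z < 0) -> forall x y, 0 < x -> x < y -> f y < f x.
Proof.
move=> dfz df0 x y x0 xy.
have [z xz zy|z /andP[xz _] E] := @gt0_MVT f df x y x0 xy.
  by apply: dfz; exact: lt_le_trans xz.
rewrite -subr_lt0 E pmulr_llt0 ?subr_gt0 //.
by apply: df0; exact: lt_trans xz.
Qed.

(** The mean value theorem uses an interior point only, so signs are needed only strictly between
    [a] and [b]. The two sign hypotheses cover the two possible orders. *)
Lemma derive_sign_descent f df (a b : R) : 0 < a -> 0 < b ->
  (forall z, 0 < z -> is_derive z 1 f (df z)) ->
  (forall z, a < z < b -> df z < 0) -> (forall z, b < z < a -> 0 < df z) ->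
  f b <= f a /\ (f b = f a -> b = a).
Proof.
move=> a0 b0 dfz neg pos; have [ab|ba|->//] := ltgtP a b.
- have [z az _|z zab E] := @gt0_MVT f df a b a0 ab; first exact/dfz/(lt_le_trans a0 az).
  suff lt_ : f b < f a by split; [exact: ltW | move=> e; move: lt_; rewrite e ltxx].
  by rewrite -subr_lt0 E pmulr_llt0 ?subr_gt0 ?neg.
- have [z bz _|z zba E] := @gt0_MVT f df b a b0 ba; first exact/dfz/(lt_le_trans b0 bz).
  suff lt_ : f b < f a by split; [exact: ltW | move=> e; move: lt_; rewrite e ltxx].
  by rewrite -subr_gt0 E pmulr_lgt0 ?subr_gt0 ?pos.
Qed.

(* Telescoping: since [f] vanishes at infinity, [f y - f x] is the sum over
   [k] of [u (x + k) - u (y + k)], whose terms are all positive. *)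
Lemma increasing_of_decreasing_increments f u C :
  (forall z, 0 < z -> `|f z| <= C / z) ->
  (forall z, 0 < z -> f (z + 1) = f z + u z) ->
  (forall x y, 0 < x -> x < y -> u y < u x) ->
  forall x y, 0 < x -> x < y -> f x < f y.
Proof.
move=> f_le fS u_decr x y x0 xy; have y0 := lt_trans x0 xy.
pose d := u x - u y; have d0 : 0 < d by rewrite subr_gt0 u_decr.
have step (N : nat) : f (y + N.+1%:R) - f (x + N.+1%:R) + d <= f y - f x.
  elim: N => [|N IH]; first by rewrite !fS // /d; lra.
  apply: le_trans IH; rewrite lerD2r.
  have xN : 0 < x + N.+1%:R by rewrite ltr_wpDr.
  have yN : 0 < y + N.+1%:R by rewrite ltr_wpDr.
  rewrite -[N.+2%:R]natr1 !addrA !fS //.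
  have := u_decr (x + N.+1%:R) (y + N.+1%:R) xN; rewrite ltrD2r => /(_ xy); lra.
have C0 : 0 <= C.
  have := le_trans (normr_ge0 _) (f_le x x0).
  by rewrite pmulr_lge0 ?invr_gt0.
have tail z (N : nat) : 0 < z -> `|f (z + N.+1%:R)| <= C / N.+1%:R.
  move=> z0; apply: le_trans (f_le _ _) _; first by rewrite ltr_wpDr.
  by rewrite ler_wpM2l // lef_pV2 ?posrE ?ltr0n ?ltr_wpDr // lerDr ltW.
(* Only the first telescoped term [d] is kept. This [N] makes the two tails, each at most
   [C / N.+1%:R], add up to less than [d]. *)
pose N := Num.truncn (2 * C / d).
have NC : 2 * C / d < N.+1%:R.
  by rewrite truncnS_gt // ?divr_ge0 ?mulr_ge0 // ltW.
have N0 : 0 < N.+1%:R :> R by rewrite ltr0n.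
have Cd : 2 * (C / N.+1%:R) < d.
  by rewrite mulrA ltr_pdivrMr // [d * _]mulrC -ltr_pdivrMr.
move: (tail x N x0) (tail y N y0) (step N) Cd.
move: (C / _) (f (x + _)) (f (y + _)) => e a b; rewrite !ler_norml.
move=> /andP[a1 a2] /andP[b1 b2]; lra.
Qed.

Lemma is_derive_ln_Gamma z : 0 < z ->
  is_derive z 1 (fun s => ln (Gamma s)) (digamma z).
Proof.
move=> z0; have dG := is_derive_Gamma z0; have G0 := Gamma_gt0 z0.
apply: (is_derive_eq (is_derive1_chain (is_derive1_ln G0) dG)).
by rewrite digammaE // mulrC.
Qed.

Lemma phi_bounds z : 0 < z -> - z^-1 <= phi z /\ phi z <= 0.
Proof.
move=> z0; rewrite /phi; have := digamma_le_ln z0; have := digamma_ge_ln z0; lra.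
Qed.

Definition log_defect z := z^-1 - (ln (z + 1) - ln z).

Lemma phiS z : 0 < z -> phi (z + 1) = phi z + log_defect z.
Proof. by move=> z0; rewrite /phi /log_defect digammaS //; lra. Qed.

(** The derivative of [log_defect] as a single fraction, which shows its sign and its
    monotonicity. *)
Definition dlog_defect z := - (z ^+ 2 * (z + 1))^-1.

Lemma is_derive_log_defect z : 0 < z ->
  is_derive z 1 log_defect (dlog_defect z).
Proof.
move=> z0; have z10 : 0 < z + 1 by rewrite addr_gt0.
have d1 := @is_derive1_inv _ id z 1 (lt0r_neq0 z0) (is_derive_id z 1).
have d2 : is_derive z 1 (fun t => ln (1 * t + 1)) ((z + 1)^-1 * 1).
  apply: is_derive1_chain; last exact: is_derive1_affine.
  by rewrite mul1r; exact: is_derive1_ln.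
have d3 := is_derive1_ln z0.
have := is_derive1_add d1 (is_derive1_opp (is_derive1_add d2 (is_derive1_opp d3))).
rewrite (_ : (fun t => _) = log_defect); last first.
  by apply/funext => t; rewrite mul1r.
move=> d4; apply: (is_derive_eq d4); rewrite /dlog_defect.
by field; rewrite !lt0r_neq0.
Qed.

Lemma dlog_defect_lt x y : 0 < x -> x < y -> dlog_defect x < dlog_defect y.
Proof.
move=> x0 xy; have y0 := lt_trans x0 xy.
have pos z : 0 < z -> 0 < z ^+ 2 * (z + 1).
  by move=> z0; rewrite mulr_gt0 ?exprn_gt0 ?addr_gt0.
rewrite ltrN2 ltf_pV2 ?posrE ?pos //.
apply: ltr_pM; rewrite ?sqr_ge0 ?addr_ge0 ?(ltW x0) ?ltrD2r //.
by rewrite ltr_sqr ?nnegrE // ltW.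
Qed.

Lemma log_defect_decreasing x y : 0 < x -> x < y -> log_defect y < log_defect x.
Proof.
apply: derive_lt0_decreasing; first exact: is_derive_log_defect.
by move=> z z0; rewrite oppr_lt0 invr_gt0 mulr_gt0 ?exprn_gt0 ?addr_gt0.
Qed.

(** The increments [log_defect] decrease, and [phi_bounds] gives the decay at infinity with constant
    1. *)
Lemma phi_increasing x y : 0 < x -> x < y -> phi x < phi y.
Proof.
apply: (@increasing_of_decreasing_increments _ log_defect 1); last exact: log_defect_decreasing.
  by move=> z z0; have := phi_bounds z0; have := ltW z0; rewrite ler_norml mul1r -invr_ge0; lra.
exact: phiS.
Qed.

(* The increments of [phi z - phi (z + h)] decrease because [log_defect] is
   strictly convex. *)
Lemma phi_gap_increasing h x y : 0 < h -> 0 < x -> x < y ->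
  phi x - phi (x + h) < phi y - phi (y + h).
Proof.
move=> h0.
(* The constant 2 allows [z^-1] for each of the two values of [phi]. *)
apply: (@increasing_of_decreasing_increments (fun z => phi z - phi (z + h))
  (fun z => log_defect z - log_defect (z + h)) 2).
- move=> z z0; have zh0 : 0 < z + h by rewrite addr_gt0.
  have : (z + h)^-1 <= z^-1 by rewrite lef_pV2 ?posrE // lerDl ltW.
  have := phi_bounds z0; have := phi_bounds zh0; rewrite ler_norml; lra.
- move=> z z0; have zh0 : 0 < z + h by rewrite addr_gt0.
  by rewrite [z + 1 + h]addrAC !phiS //; lra.
apply: (@derive_lt0_decreasing _ (fun z => dlog_defect z - dlog_defect (z + h))).
  move=> z z0; have zh0 : 0 < z + h by rewrite addr_gt0.
  have d2 : is_derive z 1 (fun t => log_defect (1 * t + h)) (dlog_defect (z + h) * 1).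
    apply: is_derive1_chain; last exact: is_derive1_affine.
    by rewrite mul1r; exact: is_derive_log_defect.
  have := is_derive1_add (is_derive_log_defect z0) (is_derive1_opp d2).
  rewrite (_ : (fun t => _) = fun t => log_defect t - log_defect (t + h)); last first.
    by apply/funext => t; rewrite mul1r.
  by move=> d3; apply: (is_derive_eq d3); rewrite mulr1.
by move=> z z0; rewrite subr_lt0; apply: dlog_defect_lt => //; rewrite ltrDl.
Qed.

End Phi.

(** * Descent in the degrees of freedom *)

Section DegreesOfFreedom.
Context {R : realType} {d n : nat}.
Variables (x : 'I_n -> 'cV[R]_d) (w : 'I_n -> R).
Variables (mu : 'cV[R]_d) (S : 'M[R]_d).
Hypothesis d_gt0 : (0 < d)%N.
Hypothesis w_gt0 : forall i, 0 < w i.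
Hypothesis w_sum1 : \sum_i w i = 1.
Hypothesis S_SPD : SPD S.

Let D i := delta x mu S i.

Let shift_gt0 (nu : R) i : 0 < nu -> 0 < nu + D i.
Proof. by move=> nu0; rewrite ltr_wpDr // delta_ge0. Qed.

Let dR_gt0 : 0 < d%:R :> R.
Proof. by rewrite ltr0n. Qed.

(** With [g] for [gamma], each summand has derivative [g' * (1 - g^-1)]. The factors are multiples
    of [D i - d%:R] with opposite signs, hence the negated square. *)
Lemma is_derive_F_b (nu : R) : 0 < nu ->
  is_derive nu 1 (F_b x w mu S)
    (- \sum_i w i * ((D i - d%:R) ^+ 2 / ((nu + D i) ^+ 2 * (nu + d%:R)))).
Proof.
move=> nu0; have nd0 : 0 < nu + d%:R by rewrite addr_gt0.
rewrite -sumrN /F_b; apply: is_derive1_sum => i.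
have D0 := shift_gt0 i nu0.
have g0 := gamma_gt0 x mu i nu0 S_SPD.
have dnum := is_derive1_affine nu 1 d%:R.
have dden := is_derive1_affine nu 1 (D i).
have den0 : 1 * nu + D i != 0 by rewrite mul1r lt0r_neq0.
have dg := is_derive1_mul dnum (@is_derive1_inv _ (fun t => 1 * t + D i) _ _ den0 dden).
rewrite (_ : (fun t => _) = fun t => gamma x t mu S i) in dg; last first.
  by apply/funext => t; rewrite !mul1r.
have dl := @is_derive1_chain _ (@ln R) (fun t => gamma x t mu S i) _ _ _
  (is_derive1_ln g0) dg.
have d1 := is_derive1_add (is_derive1_add dg (is_derive1_opp dl)) (is_derive_cst (- 1 : R) nu 1).
apply: (is_derive_eq (is_derive1_scale (w i) d1)).
by rewrite /gamma -/(D i); field; rewrite !lt0r_neq0.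
Qed.

Lemma F_b_nonincreasing (a b : R) : 0 < a -> a <= b -> F_b x w mu S b <= F_b x w mu S a.
Proof.
move=> a0; rewrite le_eqVlt => /predU1P[->//|ab].
pose dF (nu : R) :=
  - \sum_i w i * ((D i - d%:R) ^+ 2 / ((nu + D i) ^+ 2 * (nu + d%:R))).
have [z az _|z /andP[az _] E] := @gt0_MVT _ (F_b x w mu S) dF a b a0 ab.
  exact/is_derive_F_b/(lt_le_trans a0 az).
rewrite -subr_le0 E pmulr_lle0 ?subr_gt0 // oppr_le0.
have z0 := lt_trans a0 az.
apply: sumr_ge0 => i _; have D0 := shift_gt0 i z0.
apply: mulr_ge0; first exact: ltW.
apply: divr_ge0; first exact: sqr_ge0.
by apply: mulr_ge0; [exact: sqr_ge0 | rewrite ltW // addr_gt0].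
Qed.

Lemma is_derive_negloglik (nu : R) : 0 < nu ->
  is_derive nu 1 (fun t => negloglik x w t mu S)
    (phi (nu / 2) - phi ((nu + d%:R) / 2) + F_b x w mu S nu).
Proof.
move=> nu0; have nd0 : 0 < nu + d%:R by rewrite addr_gt0.
have two0 : 0 < 2 :> R by [].
have dG c : 0 <= c -> is_derive nu 1 (fun t => ln (Gamma (2^-1 * t + c)))
    (digamma (2^-1 * nu + c) * 2^-1).
  move=> c0; apply: (@is_derive1_chain _ (fun s => ln (Gamma s)) (fun t => 2^-1 * t + c)).
    by apply: is_derive_ln_Gamma; rewrite ltr_wpDr // mulr_gt0 ?invr_gt0.
  exact: is_derive1_affine.
have dG1 := is_derive1_scale (- 2) (dG (d%:R / 2) (divr_ge0 (ler0n _ _) (ltW two0))).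
have dG2 := is_derive1_scale 2 (dG 0 (lexx 0)).
have dln := is_derive1_opp (is_derive1_mul (is_derive_id nu 1) (is_derive1_ln nu0)).
have dterm i : is_derive nu 1 (fun t => w i * ln (1 * t + D i)) (w i * ((nu + D i)^-1 * 1)).
  apply: is_derive1_scale.
  apply: (@is_derive1_chain _ (@ln R) (fun t => 1 * t + D i)); last exact: is_derive1_affine.
  by rewrite mul1r; apply: is_derive1_ln; exact: shift_gt0.
have dsum := is_derive1_mul (is_derive1_affine nu 1 d%:R) (is_derive1_sum dterm).
have dall := is_derive1_add (is_derive1_add (is_derive1_add (is_derive1_add dG1 dG2) dln) dsum)
  (is_derive_cst (ln (\det S) : R) nu 1).
rewrite (_ : (fun t => _) = fun t => negloglik x w t mu S) in dall; last first.
  apply/funext => t; rewrite /negloglik addr0.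
  rewrite (_ : 2^-1 * t + d%:R / 2 = (d%:R + t) / 2); last by field.
  rewrite (eq_bigr (fun i => w i * ln (t + D i))) => [|i _]; last by rewrite mul1r.
  rewrite [2^-1 * t]mulrC /=.
  by move: (ln (Gamma ((d%:R + t) / 2))) (ln (Gamma (t / 2))) => G1 G2; ring.
apply: (is_derive_eq dall).
(* Since the weights sum to 1, [ln (nu + d%:R)] and the constant 1 leave the sum; the latter cancels
   the constant in the derivative of [nu * ln nu]. *)
have FE : F_b x w mu S nu = (nu + d%:R) * \sum_i w i * ((nu + D i)^-1 * 1)
    + \sum_i w i * ln (nu + D i) - ln (nu + d%:R) - 1.
  rewrite /F_b mulr_sumr -big_split -addrA -opprD -[X in _ - X]mul1r -[X in X * (_ + _)]w_sum1.
  rewrite mulr_suml -sumrB /=; apply: eq_bigr => i _.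
  have D0 := shift_gt0 i nu0.
  rewrite /gamma ln_div ?posrE // -/(D i); ring.
have e1 : 2^-1 * nu + d%:R / 2 = (nu + d%:R) / 2 by field.
have e0 : 2^-1 * nu + 0 = nu / 2 by rewrite addr0 mulrC.
rewrite FE /phi e1 e0 addr0.
move: (digamma (nu / 2)) (digamma ((nu + d%:R) / 2)) => G1 G2.
rewrite !ln_div ?posrE //.
rewrite (eq_bigr (fun i => w i * ln (nu + D i))) => [|i _]; last by rewrite mul1r.
by field; exact: lt0r_neq0.
Qed.

Let L (t : R) := negloglik x w t mu S.

Let half_increasing (a b : R) : 0 < a -> a < b -> phi (a / 2) < phi (b / 2).
Proof. by move=> a0 ab; apply: phi_increasing; [rewrite divr_gt0 | rewrite ltr_pM2r]. Qed.

Let gap_increasing (a b : R) : 0 < a -> a < b ->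
  phi (a / 2) - phi ((a + d%:R) / 2) < phi (b / 2) - phi ((b + d%:R) / 2).
Proof.
move=> a0 ab; rewrite !mulrDl; apply: phi_gap_increasing; rewrite ?divr_gt0 //.
by rewrite ltr_pM2r.
Qed.

(** Subtracting the update equation from the derivative of [L] at [z] leaves differences of [phi]
    between [z] and [nu'] and between [nu] and [z], and one of [F_b]. Between [nu] and [nu'] none of
    them opposes the required sign. *)
Lemma aEM_descent (nu nu' : R) : 0 < nu -> aEM_update x w mu S nu nu' ->
  L nu' <= L nu /\ (L nu' = L nu -> nu' = nu).
Proof.
move=> nu0 [nu'0 zero]; apply: derive_sign_descent (is_derive_negloglik) _ _ => //.
- move=> z /andP[az zb]; have z0 := lt_trans nu0 az.
  have := half_increasing z0 zb; have := F_b_nonincreasing nu0 (ltW az).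
  have : phi ((nu + d%:R) / 2) < phi ((z + d%:R) / 2).
    by apply: half_increasing; [rewrite addr_gt0 | rewrite ltrD2r].
  by move: zero; lra.
- move=> z /andP[az zb]; have z0 := lt_trans nu'0 az.
  have := half_increasing nu'0 az; have := F_b_nonincreasing z0 (ltW zb).
  have : phi ((z + d%:R) / 2) < phi ((nu + d%:R) / 2).
    by apply: half_increasing; [rewrite addr_gt0 | rewrite ltrD2r].
  by move: zero; lra.
Qed.

(** As for aEM, except that the two [phi] terms move together and are compared through
    [gap_increasing]. *)
Lemma MMF_descent (nu nu' : R) : 0 < nu -> MMF_update x w mu S nu nu' ->
  L nu' <= L nu /\ (L nu' = L nu -> nu' = nu).
Proof.
move=> nu0 [nu'0 zero]; apply: derive_sign_descent (is_derive_negloglik) _ _ => //.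
- move=> z /andP[az zb]; have z0 := lt_trans nu0 az.
  have := gap_increasing z0 zb; have := F_b_nonincreasing nu0 (ltW az).
  by move: zero; lra.
- move=> z /andP[az zb]; have z0 := lt_trans nu'0 az.
  have := gap_increasing nu'0 az; have := F_b_nonincreasing z0 (ltW zb).
  by move: zero; lra.
Qed.

(** The equation is strictly increasing in its unknown. In the equality case of GMMF this freezes
    the inner loop. *)
Lemma MMF_update_unique (nu a b : R) :
  MMF_update x w mu S nu a -> MMF_update x w mu S nu b -> a = b.
Proof.
move=> [a0 za] [b0 zb]; have [ab|ba|//] := ltgtP a b.
- by have := gap_increasing a0 ab; move: za zb; lra.
- by have := gap_increasing b0 ba; move: za zb; lra.
Qed.

(** Every inner iteration is an MMF step, so [L] decreases along the loop and, by continuity, down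
    to the limit. Equality makes the first inner step stationary, hence all of them. *)
Lemma GMMF_descent (nu nu' : R) : 0 < nu -> GMMF_update x w mu S nu nu' ->
  L nu' <= L nu /\ (L nu' = L nu -> nu' = nu).
Proof.
move=> nu0 [inner [inner0 innerS inner_cvg nu'0]].
have pos l : 0 < inner l by case: l => [|l]; [rewrite inner0 | case: (innerS l)].
have [le1 eq1] : L (inner 1%N) <= L nu /\ (L (inner 1%N) = L nu -> inner 1%N = nu).
  by apply: MMF_descent => //; rewrite -inner0; exact: innerS.
(* Comparing with [inner 1] instead of [inner 0] isolates the first step, whose equality case is
   then available. *)
have le_inner l : L (inner l.+1) <= L (inner 1%N).
  elim: l => [//|l IH]; apply: le_trans IH.
  by have [] := MMF_descent (pos l.+1) (innerS l.+1).
have le_lim : L nu' <= L (inner 1%N).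
  have cvgL : L (inner l.+1) @[l --> \oo] --> L nu'.
    have cL := is_derive1_continuous (is_derive_negloglik nu'0).
    by apply: continuous_cvg cL _; rewrite cvg_shiftS.
  rewrite -(cvg_lim _ cvgL) //; apply: limr_le; first by apply/cvg_ex; exists (L nu').
  exact: nearW.
split=> [|eqL]; first exact: le_trans le1.
have inner1 : inner 1%N = nu.
  by apply: eq1; apply/eqP; rewrite eq_le le1 -eqL le_lim.
have const l : inner l = nu.
  elim: l => [//|l IH]; apply: (@MMF_update_unique nu); first by rewrite -{1}IH.
  by rewrite -[X in MMF_update _ _ _ _ _ X]inner1 -{1}inner0.
apply: (cvg_unique _ inner_cvg).
  exact: norm_hausdorff.
by rewrite (_ : inner = cst nu); [exact: cvg_cst | apply/funext].
Qed.

End DegreesOfFreedom.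

(** * Descent over a complete iteration *)

Theorem theorem5p5 (R : realType) (d n : nat)
  (x : 'I_n -> 'cV[R]_d) (w : 'I_n -> R) (alg : algorithm)
  (nu : nat -> R) (mu : nat -> 'cV[R]_d) (Sigma : nat -> 'M[R]_d) :
  (0 < d)%N ->
  (d + 1 <= n)%N ->
  (forall i, 0 < w i) ->
  \sum_(i < n) w i = 1 ->
  generated_by x w alg nu mu Sigma ->
  forall r : nat,
    negloglik x w (nu r) (mu r) (Sigma r)
      >= negloglik x w (nu r.+1) (mu r.+1) (Sigma r.+1) /\
    (negloglik x w (nu r) (mu r) (Sigma r)
       = negloglik x w (nu r.+1) (mu r.+1) (Sigma r.+1) <->
     (nu r, mu r, Sigma r) = (nu r.+1, mu r.+1, Sigma r.+1)).
Proof.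
move=> d0 _ w0 w1 [pos rec_] r.
have [nu0 SP] := pos r; have [_ SP'] := pos r.+1.
have [muE SE upd] := rec_ r.
have [] := @location_scatter_descent R d n x w w0 w1 (nu r) (mu r) (Sigma r) nu0 SP.
  by rewrite -SE.
rewrite -muE -SE => le1 eq1.
have [le2 eq2] : negloglik x w (nu r.+1) (mu r.+1) (Sigma r.+1)
      <= negloglik x w (nu r) (mu r.+1) (Sigma r.+1) /\
    (negloglik x w (nu r.+1) (mu r.+1) (Sigma r.+1)
      = negloglik x w (nu r) (mu r.+1) (Sigma r.+1) -> nu r.+1 = nu r).
  by case: alg upd {rec_} => /=; [exact: aEM_descent | exact: MMF_descent | exact: GMMF_descent].
split; first exact: le_trans le1.
split=> [eqL|[-> -> ->] //].
(* The total decrease is the sum of two nonnegative ones, so equality forces both to vanish. *)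
have [muE' SE'] : mu r.+1 = mu r /\ Sigma r.+1 = Sigma r.
  by apply: eq1; apply/eqP; rewrite eq_le le1 eqL le2.
by rewrite muE' SE' eq2 //; apply/eqP; rewrite eq_le le2 -eqL le1.
Qed.
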